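(* Let $V$ be a vertex ring with vacuum element $\mathbf{1}$. For $m\ge 0$ define $D_m\in \mathrm{End}(V)$ by $D_m(u):=u(-m-1)\mathbf{1}$ for $u\in V$; equivalently, $Y(u,z)\mathbf{1}=\sum_{m\ge 0}D_m(u)z^m$. Then $\underline{D}:=(D_0,D_1,D_2,\dots)$ is an iterative Hasse--Schmidt derivation of $V$.
   Context: A vertex ring is an additive abelian group $V$ with biadditive products $(u,v)\mapsto u(n)v$ for all $n\in\mathbf{Z}$ and a distinguished element $\mathbf{1}\in V$ (the vacuum) such that for all $u,v,w\in V$: (a) there is an integer $n_0(u,v)\ge 0$ with $u(n)v=0$ for all $n\ge n_0$; (b) $u(-1)\mathbf{1}=u$ and $u(n)\mathbf{1}=0$ for $n\ge 0$; (c) for all $r,s,t\in\mathbf{Z}$, $\sum_{i\ge 0}\binom{r}{i}(u(t+i)v)(r+s-i)w=\sum_{i\ge 0}(-1)^i\binom{t}{i}\{u(r+t-i)v(s+i)w-(-1)^t v(s+t-i)u(r+i)w\}$. Here $\binom{m}{n}=m(m-1)\cdots(m-n+1)/n!$ for $m\in\mathbf{Z}$, $n\ge 1$, and $\binom{m}{0}=1$. $\mathrm{End}(V)$ is the ring of additive endomorphisms of $V$, and $Y(u,z):=\sum_{n\in\mathbf{Z}}u(n)z^{-n-1}\in \mathrm{End}(V)[[z,z^{-1}]]$. A Hasse--Schmidt (HS) derivation of a vertex ring $V$ is a sequence $\underline{D}=(D_0,D_1,\dots)$ of elements of $\mathrm{End}(V)$ with $D_0=\mathrm{Id}_V$ such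 that $D_m(u(n)v)=\sum_{i+j=m}D_i(u)(n)D_j(v)$ for all $u,v\in V$, $n\in\mathbf{Z}$, $m\ge 0$. It is iterative if $D_i\circ D_j=\binom{i+j}{i}D_{i+j}$ for all $i,j\ge 0$. *)

(* Defs.v *)
From HB Require Import structures.
From mathcomp Require Import all_boot all_order all_algebra.
From mathcomp Require Import boolp classical_sets fsbigop.

Set Implicit Arguments.
Unset Strict Implicit.
Unset Printing Implicit Defensive.

Import GRing.Theory.

Local Open Scope classical_set_scope.
Local Open Scope ring_scope.

(* The integer division is exact, see [zbinomE]. *)
Definition zbinom (m : int) (n : nat) : int :=
  ((\prod_(i < n) (m - i%:Z)) %/ n`!%:Z)%Z.

Lemma zbinom_nat (m n : nat) : \prod_(i < n) (m%:Z - i%:Z) = (m ^_ n)%:Z.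
Proof.
elim: n => [|n IHn]; first by rewrite big_ord0.
rewrite big_ord_recr /= IHn ffactnSr PoszM.
have [le_nm|lt_mn] := leqP n m; first by rewrite -subzn.
by rewrite ffact_small // !mul0r.
Qed.

Lemma zbinom_neg (m n : nat) :
  \prod_(i < n) (- m%:Z - i%:Z) = (-1) ^+ n * ((m + n).-1 ^_ n)%:Z.
Proof.
case: m => [|m].
  case: n => [|n]; first by rewrite big_ord0.
  by rewrite add0n ffact_small // mulr0 big_ord_recl oppr0 subrr mul0r.
have -> : ((m.+1 + n).-1 ^_ n)%:Z = \prod_(i < n) (m.+1%:Z + i%:Z).
  elim: n => [|n IHn]; first by rewrite big_ord0.
  rewrite big_ord_recr /= -IHn addSn addnS [RHS]mulrC.
  by rewrite -PoszD -PoszM -ffactnS addSn.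
rewrite -[n in (-1) ^+ n]card_ord -prodrN.
by apply: eq_bigr => i _; rewrite opprD.
Qed.

Lemma zbinomE (m : int) (n : nat) :
  zbinom m n * n`!%:Z = \prod_(i < n) (m - i%:Z).
Proof.
rewrite /zbinom; apply: divzK.
have dvd_ffact k : (n`!%:Z %| (k ^_ n)%:Z)%Z.
  by rewrite -bin_ffact PoszM dvdz_mull.
case: m => [m|m]; first by rewrite zbinom_nat.
by rewrite NegzE zbinom_neg dvdz_mull.
Qed.

Reserved Notation "u <( n )> v"
  (at level 40, n at level 200, left associativity, format "u  <( n )>  v").

(* [nprod n u v] is u(n)v.  The sums in the Jacobi identity are over all
   natural numbers; [nprod_trunc] makes their supports finite, so that the
   finitely supported sums of [fsbigop] have their intended value. *)
HB.mixin Record Zmodule_isVertexRing V of GRing.Zmodule V := {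
  nprod : int -> V -> V -> V;
  vacuum : V;
  nprodDl : forall n u v w, nprod n (u + v) w = nprod n u w + nprod n v w;
  nprodDr : forall n u v w, nprod n u (v + w) = nprod n u v + nprod n u w;
  nprod_trunc : forall u v,
    exists n0 : nat, forall n : int, n0%:Z <= n -> nprod n u v = 0;
  nprod_vacuumN1 : forall u, nprod (-1) u vacuum = u;
  nprod_vacuum_ge0 : forall u (n : int), 0 <= n -> nprod n u vacuum = 0;
  nprod_jacobi : forall (u v w : V) (r s t : int),
    \sum_(i \in [set: nat])
        nprod (r + s - i%:Z) (nprod (t + i%:Z) u v) w *~ zbinom r i
    = \sum_(i \in [set: nat])
        (nprod (r + t - i%:Z) u (nprod (s + i%:Z) v w)
         - nprod (s + t - i%:Z) v (nprod (r + i%:Z) u w) *~ ((-1 : int) ^ t))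
        *~ ((-1) ^+ i * zbinom t i)
}.

#[short(type="vertexRingType")]
HB.structure Definition VertexRing :=
  {V of Zmodule_isVertexRing V & GRing.Zmodule V}.

Arguments vacuum {s}.
Notation "u <( n )> v" := (nprod n u v) : ring_scope.

Section Endomorphisms.
Variable V : vertexRingType.

Lemma nprod_is_zmod_morphism (n : int) (u : V) :
  zmod_morphism (fun v => u <( n )> v).
Proof.
by move=> v w; apply: (addIr (u <( n )> w)); rewrite -nprodDr !subrK.
Qed.

Lemma nprodr_is_zmod_morphism (n : int) (v : V) :
  zmod_morphism (fun u => u <( n )> v).
Proof.
by move=> u w; apply: (addIr (w <( n )> v)); rewrite -nprodDl !subrK.
Qed.

HB.instance Definition _ (n : int) (u : V) :=
  GRing.isZmodMorphism.Build V V (nprod n u) (nprod_is_zmod_morphism n u).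

(* A formal series in End(V)[[z, z^-1]] is the function sending k to its
   coefficient of z^k; that of Y(u, z) is u(-k-1). *)
Definition vertexY (u : V) (k : int) : {additive V -> V} := nprod (- k - 1) u.

Definition hsD_fun (m : nat) (u : V) : V := u <( - m%:Z - 1 )> vacuum.

HB.instance Definition _ (m : nat) :=
  GRing.isZmodMorphism.Build V V (hsD_fun m)
    (nprodr_is_zmod_morphism (- m%:Z - 1) vacuum).

Definition hsD (m : nat) : {additive V -> V} := hsD_fun m.

Definition HS_derivation (D : nat -> {additive V -> V}) : Prop :=
  D 0%N =1 id /\
  forall (u v : V) (n : int) (m : nat),
    D m (u <( n )> v) = \sum_(i < m.+1) D i u <( n )> D (m - i)%N v.

Definition iterative (D : nat -> {additive V -> V}) : Prop :=
  forall i j : nat, D i \o D j =1 (fun u => D (i + j)%N u *+ 'C(i + j, i)).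

End Endomorphisms.

Arguments hsD : clear implicits.

(* The power series sum_(m >= 0) f m z^m as a series in V[[z, z^-1]]. *)
Definition power_series (V : zmodType) (f : nat -> V) (k : int) : V :=
  if k is Posz m then f m else 0.

(* Main.v *)
Require Import Defs.
From HB Require Import structures.
From mathcomp Require Import all_boot all_order all_algebra.
From mathcomp Require Import classical_sets fsbigop.
From mathcomp Require Import zify.

(** Write [1] for the vacuum.  For [r = 0] and [w = 1] the Jacobi identity gives
    [D_m (u(t)v) = \sum_(i <= m) (-1)^i C(t, i) u(t - i) (D_(m - i) v)], so
    both claims follow once [D_m(u)(n) = (-1)^m C(n, m) u(n - m)]; for the
    iteration rule, apply this to the vacuum with [n = - i - 1].  This last formula is
    again associativity, for [(u(- m - 1)1)(n)w], provided [1(n)] is zero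
    for [n <> -1] and the identity for [n = -1].  Locality of the vacuum gives
    [1(n)u = u(-1)(1(n)1)], and [D_m 1 = 0] for [m > 0] by induction on [m],
    since the expansion of [D_m (1(-1)1)] reads [D_m 1 = D_m 1 + D_m 1]. *)

Import GRing.Theory.
Local Open Scope ring_scope.

Lemma fsbig_only (T : choiceType) (M : nmodType) (F : T -> M) (j : T) :
  (forall i, i != j -> F i = 0) -> \sum_(i \in [set: T]%classic) F i = F j.
Proof.
move=> F0; have <- : \sum_(i \in [set j]%classic) F i = F j by rewrite fsbig_set1.
apply/esym/fsbig_widen => //.
by move=> i [_ /= /eqP neq_ij]; apply: F0.
Qed.

Lemma fsbig_trunc (M : nmodType) (F : nat -> M) (n : nat) :
  (forall i, (n <= i)%N -> F i = 0) ->
  \sum_(i \in [set: nat]%classic) F i = \sum_(i < n) F i.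
Proof.
move=> F0; rewrite fsbig_ord; apply/esym/fsbig_widen => //.
by move=> i [_ /= /negP]; rewrite -leqNgt => /F0.
Qed.

(** A case split on [int] presents the index of D_m as [Negz m], which is also the form
    [zbinom_Negz] expects. *)
Lemma opprB1_Negz (m : nat) : - m%:Z - 1 = Negz m.
Proof. by rewrite NegzE -addn1 PoszD opprD. Qed.

Lemma zbinom_unique (m k : int) (n : nat) :
  \prod_(i < n) (m - i%:Z) = k * n`!%:Z -> zbinom m n = k.
Proof.
rewrite -zbinomE; apply: mulIf.
by rewrite eqz_nat -lt0n fact_gt0.
Qed.

Lemma zbinom_bin (m n : nat) : zbinom m%:Z n = 'C(m, n).
Proof. by apply: zbinom_unique; rewrite zbinom_nat -bin_ffact PoszM. Qed.

Lemma zbinom_Negz (m n : nat) :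
  zbinom (Negz m) n = (-1) ^+ n * 'C(m + n, n)%:Z.
Proof.
by apply: zbinom_unique; rewrite NegzE zbinom_neg -bin_ffact PoszM mulrA.
Qed.

Lemma zbinom0l (n : nat) : zbinom 0 n = (n == 0)%:Z.
Proof. by rewrite zbinom_bin bin0n. Qed.

Lemma zbinom0r (m : int) : zbinom m 0 = 1.
Proof. by apply: zbinom_unique; rewrite big_ord0. Qed.

Section VertexRing.
Variable V : vertexRingType.
Implicit Types (u v w : V) (m : nat) (n r s t : int).

Lemma nprod0l n v : (0 : V) <( n )> v = 0.
Proof. by have := nprodr_is_zmod_morphism n v 0 0; rewrite !subrr. Qed.

Lemma nprod_associator u v w s t :
  u <( t )> v <( s )> w
  = \sum_(i \in [set: nat]%classic)
      (u <( t - i%:Z )> (v <( s + i%:Z )> w)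
       - v <( s + t - i%:Z )> (u <( i%:Z )> w) *~ ((-1 : int) ^ t))
      *~ ((-1) ^+ i * zbinom t i).
Proof.
have := nprod_jacobi u v w 0 s t.
rewrite (fsbig_only _ _ _ (0%N)); last first.
  by move=> i /negPf i0; rewrite zbinom0l i0 mulr0z.
rewrite zbinom0l mulr1z addr0 add0r subr0 => ->.
by apply: eq_fsbigr => i _; rewrite !add0r.
Qed.

Lemma hsD_nprod u v t m :
  hsD V m (u <( t )> v)
  = \sum_(i < m.+1) u <( t - i%:Z )> hsD V (m - i) v *~ ((-1) ^+ i * zbinom t i).
Proof.
(* Here s = - m - 1, so s + i >= 0 once i > m and the sum stops at m; the other half of each term
   contains u(i)1 = 0. *)
rewrite /hsD /= /hsD_fun nprod_associator (fsbig_trunc _ _ (m.+1)).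
  apply: eq_bigr => i _; rewrite (nprod_vacuum_ge0 u) // raddf0 mul0rz subr0.
  by congr (_ <( _ )> (_ <( _ )> _) *~ _); have := ltn_ord i; lia.
move=> i lt_mi; rewrite (nprod_vacuum_ge0 u) // nprod_vacuum_ge0; last by lia.
by rewrite !raddf0 mul0rz subr0 mul0rz.
Qed.

(** Take r = -1, s = n, t = 0 and v = w = 1 in the Jacobi identity: the left side vanishes since
    u(i)1 = 0 for i >= 0, and the right side is the commutator of u(-1) and 1(n) applied to 1. *)
Lemma vacuum_nprodE n u : vacuum <( n )> u = u <( -1 )> (vacuum <( n )> vacuum).
Proof.
have := nprod_jacobi u vacuum vacuum (-1) n 0.
rewrite fsbig1 => [|i _]; last first.
  by rewrite (nprod_vacuum_ge0 u) ?nprod0l ?mul0rz.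
rewrite (fsbig_only _ _ _ (0%N)); last first.
  by move=> i /negPf i0; rewrite zbinom0l i0 mulr0 mulr0z.
rewrite zbinom0r !mulr1z !addr0 nprod_vacuumN1.
by move/esym/eqP; rewrite subr_eq0 => /eqP.
Qed.

Lemma vacuum_nprodN1 u : vacuum <( -1 )> u = u.
Proof. by rewrite vacuum_nprodE !nprod_vacuumN1. Qed.

Lemma hsD_vacuum m : hsD V m.+1 vacuum = 0.
Proof.
elim/ltn_ind: m => m IHm.
have := hsD_nprod vacuum vacuum (-1) m.+1.
(* The inner terms contain D_k 1 with 0 < k <= m, zero by induction. *)
rewrite nprod_vacuumN1 big_ord_recl big_ord_recr big1 /= => [|i _]; last first.
  rewrite /bump leq0n add1n subSS.
  have -> : (m - i = (m - i.+1).+1)%N by have := ltn_ord i; lia.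
  by rewrite [hsD_fun _ _]IHm ?raddf0 ?mul0rz //; have := ltn_ord i; lia.
rewrite zbinom0r mulr1z subr0 subn0 vacuum_nprodN1 add0r.
(* The last term is 1(- m - 2)1 = D_(m+1) 1, with coefficient (-1)^(m+1) C(-1, m+1) = 1. *)
rewrite /bump leq0n add1n subnn -[-1]/(Negz 0) zbinom_Negz add0n binn.
rewrite signrMK mulr1z.
rewrite {3}/hsD_fun opprB1_Negz nprod_vacuumN1.
rewrite [Negz 0 - _]addrC opprB1_Negz -opprB1_Negz -/(hsD_fun _ _).
by move/eqP; rewrite -subr_eq subrr => /eqP.
Qed.

Lemma vacuum_nprod n u : n != -1 -> vacuum <( n )> u = 0.
Proof.
move=> nN1; rewrite vacuum_nprodE; case: n nN1 => [n|[|n]] // _.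
  by rewrite nprod_vacuum_ge0 ?raddf0.
by rewrite -opprB1_Negz [X in _ <( _ )> X]hsD_vacuum raddf0.
Qed.

(** Since 1(k) = 0 for k <> -1, at most one term of the associativity sum survives: i = n - m in the
    second half if n >= m, none if 0 <= n < m, and i = - n - 1 in the first half if n < 0. *)
Lemma nprod_hsDl m u n w :
  hsD V m u <( n )> w = u <( n - m%:Z )> w *~ ((-1) ^+ m * zbinom n m).
Proof.
rewrite /hsD /= /hsD_fun nprod_associator opprB1_Negz.
case: n => n.
  have [le_mn|lt_nm] := leqP m n.
    rewrite (fsbig_only _ _ _ ((n - m)%N)) => [|i neq_i].
      rewrite vacuum_nprod; last by lia.
      have -> : n%:Z + Negz m - (n - m)%N%:Z = -1 by lia.
      rewrite vacuum_nprodN1 raddf0 sub0r -mulrNz.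
      (* The minus sign of the second half and (-1)^(- m - 1) combine to (-1)^m. *)
      rewrite [_ ^ Negz m]invr_sign exprS mulN1r opprK -subzn // -mulrzA.
      by rewrite zbinom_Negz signrMK subnKC // bin_sub // zbinom_bin.
    rewrite !vacuum_nprod ?raddf0 ?mul0rz ?subr0 ?mul0rz //; lia.
  rewrite zbinom_bin bin_small // mulr0 mulr0z fsbig1 // => i _.
  rewrite !vacuum_nprod ?raddf0 ?mul0rz ?subr0 ?mul0rz //; lia.
rewrite (fsbig_only _ _ _ (n)) => [|i neq_i].
  rewrite (vacuum_nprod (_ - _)); last by lia.
  have -> : Negz n + n%:Z = -1 by lia.
  rewrite vacuum_nprodN1 mul0rz subr0 !zbinom_Negz.
  have -> : Negz m - n%:Z = Negz n - m%:Z by lia.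
  rewrite !signrMK addnC.
  (* Both coefficients are now unsigned, and agree by the symmetry C(m + n, n) = C(m + n, m). *)
  by rewrite -[in LHS](bin_sub (leq_addr _ _)) addKn.
rewrite !vacuum_nprod ?raddf0 ?mul0rz ?subr0 ?mul0rz //; lia.
Qed.

End VertexRing.

Theorem theorem3p5 (V : vertexRingType) :
  (forall D : nat -> {additive V -> V},
     (forall m : nat, D m =1 hsD V m) <->
     (forall u : V,
        (fun k : int => vertexY u k vacuum) =1
        power_series (fun m : nat => D m u))) /\
  HS_derivation (hsD V) /\ iterative (hsD V).
Proof.
split.
  move=> D; split=> [DE u [m|m]|DE m u]; rewrite /vertexY /=.
  - by rewrite DE.
  - by rewrite nprod_vacuum_ge0 // NegzE; lia.
  - exact/esym/(DE u m).
split.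
  split=> [u|u v n m]; first exact: nprod_vacuumN1.
  by rewrite hsD_nprod; apply: eq_bigr => i _; rewrite nprod_hsDl.
move=> i j u; rewrite /= {1}/hsD_fun [LHS]nprod_hsDl opprB1_Negz zbinom_Negz.
(* The signs cancel: (-1)^j C(- i - 1, j) = C(i + j, j). *)
rewrite signrMK -pmulrn.
rewrite -[in 'C(i + j, j)](bin_sub (leq_addl _ _)) addnK /hsD_fun.
by congr (_ <( _ )> _ *+ _); lia.
Qed.
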